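(* Let $\phi(t)=(q(t),p(t))$ be a bound Kepler orbit with energy $H<0$, eccentricity $0\le e<1$, and periapsis at $t=0$, and let $\varepsilon(t)$ be its eccentric anomaly. Write $S(\phi(t))=(r(t),s(t),\sqrt{-2H})$, and let $\theta(t)$ be the function with $\theta(0)=0$ and $\dot\theta(t)=\dfrac{\sqrt{-2H}}{|q(t)|}$ for which $$r(t)=\cos\theta(t)\,r(0)+\sin\theta(t)\,s(0),\qquad s(t)=-\sin\theta(t)\,r(0)+\cos\theta(t)\,s(0).$$ Then $\theta(t)=\varepsilon(t)$ for all $t$.
   Context: The Kepler Hamiltonian is $H(q,p)=\frac12|p|^2-|q|^{-1}$ on $T^*(\mathbb R^3\setminus\{0\})=\{(q,p)\in\mathbb R^3\times\mathbb R^3: q\ne0\}$; a Kepler orbit is a solution of $\dot q=p$, $\dot p=-q/|q|^3$, and $H$ is constant along it. Let $\Sigma_-=\{(q,p): q\neq 0,\ H(q,p)<0\}$ and $T_1^*S^3=\{(x,y)\in\mathbb R^4\times\mathbb R^4: |x|=|y|=1,\ \langle x,y\rangle=0\}$. Define $S:\Sigma_-\to T_1^*S^3\times\mathbb R_{>0}$ by $S(q,p)=[(r_0,\vec r),(s_0,\vec s),\sqrt{-2H}]$, where $$r_0=|p|^2|q|-1,\quad \vec r=\sqrt{-2H}\,|q|\,p,\quad s_0=-\sqrt{-2H}\,\langle q,p\rangle,\quad \vec s=-\Big(\frac{q}{|q|}-\langle q,p\rangle p\Big).$$ For a bound orbit with semi-major axis $a=-\frac1{2H}$, eccentricity $e$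 and periapsis at $t=0$, the eccentric anomaly $\varepsilon(t)$ (continuous, with $\varepsilon(0)=0$) and mean anomaly $M(t)$ satisfy $|q(t)|=a(1-e\cos\varepsilon(t))$ and $M(t)=\varepsilon(t)-e\sin\varepsilon(t)=\omega t$, with $\omega=a^{-3/2}$. *)

(* Defs.v *)
From HB Require Import structures.
From mathcomp Require Import all_boot all_order all_algebra.
From mathcomp Require Import ring lra.
From mathcomp Require Import all_classical all_reals all_analysis.

Set Implicit Arguments.
Unset Strict Implicit.
Unset Printing Implicit Defensive.

Import Order.TTheory GRing.Theory Num.Theory.
Import numFieldNormedType.Exports.

Local Open Scope classical_set_scope.
Local Open Scope ring_scope.

Section Kepler.
Variable R : realType.

(* The norm `|u| that the library puts on row vectors is the sup norm, so the
   Euclidean structure is introduced separately.  Derivatives do not depend on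
   this choice. *)
Definition dot n (u v : 'rV[R]_n) : R := \sum_(i < n) u 0 i * v 0 i.
Definition enorm n (u : 'rV[R]_n) : R := Num.sqrt (dot u u).

Implicit Types q p : 'rV[R]_3.

Definition hamiltonian q p : R := enorm p ^+ 2 / 2 - (enorm q)^-1.

Definition Sigma_minus : set ('rV[R]_3 * 'rV[R]_3) :=
  [set z | z.1 != 0 /\ hamiltonian z.1 z.2 < 0].

Definition T1S3 : set ('rV[R]_4 * 'rV[R]_4) :=
  [set z | [/\ enorm z.1 = 1, enorm z.2 = 1 & dot z.1 z.2 = 0]].

(* The pair (x0, x) in R x R^3, seen as a vector of R^4. *)
Definition vec4 (x0 : R) (x : 'rV[R]_3) : 'rV[R]_4 :=
  row_mx (x0%:M : 'rV[R]_1) x.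

(* Total function; only its restriction to Sigma_minus is meaningful, see
   Smap_Sigma_minus below. *)
Definition Smap q p : 'rV[R]_4 * 'rV[R]_4 * R :=
  let w := Num.sqrt (- (2 * hamiltonian q p)) in
  (vec4 (enorm p ^+ 2 * enorm q - 1) ((w * enorm q) *: p),
   vec4 (- (w * dot q p)) (- ((enorm q)^-1 *: q - dot q p *: p)),
   w).

Definition kepler_orbit (q p : R -> 'rV[R]_3) : Prop :=
  [/\ forall t, q t != 0,
      forall t : R, is_derive t (1 : R) q (p t)
    & forall t : R, is_derive t (1 : R) p (- ((enorm (q t) ^+ 3)^-1 *: q t))].

(* Laplace-Runge-Lenz vector p x (q x p) - q / |q|, with the double cross
   product expanded as |p|^2 q - <q, p> p. *)
Definition eccentricity_vector q p : 'rV[R]_3 :=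
  (enorm p ^+ 2 *: q - dot q p *: p) - (enorm q)^-1 *: q.

Definition eccentricity q p : R := enorm (eccentricity_vector q p).

Definition periapsis_at0 (q : R -> 'rV[R]_3) : Prop :=
  forall t, enorm (q 0) <= enorm (q t).

Definition semi_major_axis (h : R) : R := - (2 * h)^-1.

Definition mean_motion (a : R) : R := a `^ (- (3 / 2)).

Definition mean_anomaly (e : R) (eps : R -> R) (t : R) : R :=
  eps t - e * sin (eps t).

(* The last clause (Kepler's equation) determines eps uniquely; the radial
   equation alone would not, e.g. for circular orbits. *)
Definition eccentric_anomaly (q : R -> 'rV[R]_3) (a e : R) (eps : R -> R) :
    Prop :=
  [/\ continuous eps,
      eps 0 = 0,
      forall t, enorm (q t) = a * (1 - e * cos (eps t))
    & forall t, mean_anomaly e eps t = mean_motion a * t].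

Lemma dotC n (u v : 'rV[R]_n) : dot u v = dot v u.
Proof. by apply: eq_bigr => i _; rewrite mulrC. Qed.

Lemma dotDl n (u v w : 'rV[R]_n) : dot (u + v) w = dot u w + dot v w.
Proof. by rewrite -big_split; apply: eq_bigr => i _; rewrite mxE mulrDl. Qed.

Lemma dotZl n a (u w : 'rV[R]_n) : dot (a *: u) w = a * dot u w.
Proof. by rewrite /dot mulr_sumr; apply: eq_bigr => i _; rewrite mxE mulrA. Qed.

Lemma dotNl n (u w : 'rV[R]_n) : dot (- u) w = - dot u w.
Proof. by rewrite -scaleN1r dotZl mulN1r. Qed.

Lemma dotDr n (u v w : 'rV[R]_n) : dot w (u + v) = dot w u + dot w v.
Proof. by rewrite !(dotC w) dotDl. Qed.

Lemma dotZr n a (u w : 'rV[R]_n) : dot w (a *: u) = a * dot w u.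
Proof. by rewrite !(dotC w) dotZl. Qed.

Lemma dotNr n (u w : 'rV[R]_n) : dot w (- u) = - dot w u.
Proof. by rewrite !(dotC w) dotNl. Qed.

Lemma dot_ge0 n (u : 'rV[R]_n) : 0 <= dot u u.
Proof. by apply: sumr_ge0 => i _; rewrite -expr2 sqr_ge0. Qed.

Lemma enorm_sqr n (u : 'rV[R]_n) : enorm u ^+ 2 = dot u u.
Proof. exact/sqr_sqrtr/dot_ge0. Qed.

Lemma enorm_gt0 n (u : 'rV[R]_n) : u != 0 -> 0 < enorm u.
Proof.
move=> u0; rewrite sqrtr_gt0 lt_neqAle dot_ge0 andbT eq_sym.
apply: contraNneq u0 => /eqP; rewrite psumr_eq0; last first.
  by move=> i _; rewrite -expr2 sqr_ge0.
move=> /allP u0; apply/eqP/rowP => i; rewrite mxE.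
by have := u0 i (mem_index_enum _); rewrite mulf_eq0 orbb => /eqP.
Qed.

Lemma dot_vec4 a b (u v : 'rV[R]_3) :
  dot (vec4 a u) (vec4 b v) = a * b + dot u v.
Proof.
rewrite /dot (@big_split_ord _ _ _ 1 3) /= big_ord1; congr (_ * _ + _).
- by rewrite /vec4 (@row_mxEl _ 1 1 3) mxE.
- by rewrite /vec4 (@row_mxEl _ 1 1 3) mxE.
- by apply: eq_bigr => i _; rewrite /vec4 !(@row_mxEr _ 1 1 3).
Qed.

Lemma Smap_Sigma_minus q p : Sigma_minus (q, p) ->
  T1S3 (Smap q p).1 /\ 0 < (Smap q p).2.
Proof.
case=> /= q0 h0.
have w0 : 0 < - (2 * hamiltonian q p) by lra.
have hw := sqr_sqrtr (ltW w0).
rewrite -sqrtr_gt0 in w0; split=> //.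
move: w0 hw; rewrite /Smap /=; set w := Num.sqrt (- _) => w0.
rewrite /hamiltonian.
have n0 : enorm q != 0 by rewrite gt_eqF ?enorm_gt0.
move: (enorm_sqr q) (enorm_sqr p) n0; set n := enorm q; set m := enorm p => hn hm n0 hw.
have hP : dot p p = 2 / n - w ^+ 2 by rewrite -hm hw; field.
have pq := dotC p q.
have sq1 (x : R) : x = 1 -> Num.sqrt x = 1 by move=> ->; exact: sqrtr1.
rewrite /T1S3 /=; split; [apply: sq1|apply: sq1|];
  rewrite dot_vec4 ?hm !(dotDl, dotNl, dotZl, dotDr, dotNr, dotZr) ?pq -?hn hP;
  by field.
Qed.

End Kepler.

(* Main.v *)
Require Import Defs.
From mathcomp Require Import all_boot all_order all_algebra.
From mathcomp Require Import ring lra.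
From mathcomp Require Import all_classical all_reals all_analysis.
Import Order.TTheory GRing.Theory Num.Theory.
Import numFieldNormedType.Exports.
Local Open Scope ring_scope.

(** With [w = sqrt (- 2 h)] and [a = w^-2], the mean motion is [w ^ 3].
    Differentiating Kepler's equation [eps - e sin eps = w ^ 3 t] gives
    [eps' = w ^ 3 / (1 - e cos eps) = w / |q| = theta'], and both angles vanish
    at [0].  Since [eps] is not assumed differentiable, its derivative comes from
    the inverse function theorem applied to [x |-> x - e sin x]. *)

Section KeplerEquation.
Context {R : realType}.
Implicit Types (e n x t : R) (eps : R -> R).

(** The factor [n] lets one formula serve both the monotonicity proof, with [n = 1], and the inverse
    function [K] below, with the inverse mean motion. *)
Lemma is_derive_kepler e n x :
  is_derive x (1 : R) (fun y => n * (y - e * sin y)) (n * (1 - e * cos x)).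
Proof.
have dK : is_derive x (1 : R) (n \*: (id - e \*: (sin : R -> R)))
                    (n *: (1 - e *: cos x)) by exact: is_deriveZ.
exact: dK.
Qed.

Lemma kepler_slope_gt0 e x : 0 <= e < 1 -> 0 < 1 - e * cos x.
Proof.
case/andP=> e0 e1; rewrite subr_gt0 (le_lt_trans _ e1)//.
by rewrite ler_piMr ?cos_le1.
Qed.

Lemma kepler_lt e : 0 <= e < 1 -> {homo (fun x => x - e * sin x) : x y / x < y}.
Proof.
move=> he x y xy /=.
have dK z : is_derive z (1 : R) (fun y => y - e * sin y) (1 - e * cos z).
  have := is_derive_kepler e 1 z; rewrite mul1r.
  by under eq_fun do rewrite mul1r.
have [|c _] := @MVT _ (fun z => z - e * sin z) (fun z => 1 - e * cos z) x y xy.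
- apply: derivable_within_continuous => z _.
  by have [] := dK z.
- move=> E; rewrite -subr_gt0 E.
  by rewrite pmulr_rgt0 ?kepler_slope_gt0// subr_gt0.
Qed.

Lemma is_derive_kepler_solution e n eps t : 0 <= e < 1 -> n != 0 ->
    (forall t, eps t - e * sin (eps t) = n * t) ->
  is_derive t (1 : R) eps (n / (1 - e * cos (eps t))).
Proof.
move=> he n0 kep.
(* [K] gives the time at which the eccentric anomaly is [x]; [eps] will be its two-sided inverse. *)
pose K x := n^-1 * (x - e * sin x).
have KE u : K (eps u) = u by rewrite /K kep mulKf.
have epsK x : eps (K x) = x.
  (* Both [eps (K x)] and [x] have mean anomaly [n * K x], and strict monotonicity makes the mean
     anomaly injective. *)
  apply: (inc_inj (le_mono (kepler_lt e he))) => /=.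
  by rewrite kep /K mulVKf.
have dK x : is_derive x (1 : R) K (n^-1 * (1 - e * cos x)).
  exact: is_derive_kepler.
(* The base point becomes [K (eps t)] and the derivative the inverse of the slope of [K] at
   [eps t]. *)
rewrite -{1}(KE t) -{1}(invrK n) -invfM.
apply: (is_derive_inverse _ _ (dK (eps t))).
- by near=> x; exact: epsK.
- near=> x; apply/differentiable_continuous/derivable1_diffP.
  by have [] := dK x.
- by rewrite mulf_neq0 ?invr_eq0// gt_eqF ?kepler_slope_gt0.
Unshelve. all: by end_near.
Qed.

End KeplerEquation.

Lemma semi_major_axisE (R : realType) (h : R) : h < 0 ->
  semi_major_axis h = (Num.sqrt (- (2 * h)) ^+ 2)^-1.
Proof. by move=> h0; rewrite sqr_sqrtr ?invrN//; lra. Qed.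

(** As real powers of [w], the exponents multiply: [-2 * -(3/2) = 3]. *)
Lemma mean_motionE (R : realType) (w : R) : 0 < w ->
  mean_motion (w ^+ 2)^-1 = w ^+ 3.
Proof.
move=> w0; rewrite /mean_motion -powR_mulrn ?ltW// -powRN -powRrM.
by rewrite (_ : - 2 * - (3 / 2) = 3%:R) ?powR_mulrn ?ltW//; field.
Qed.

Theorem theorem4p8 (R : realType) (q p : R -> 'rV[R]_3) (h e : R)
  (eps theta : R -> R) (r s : R -> 'rV[R]_4)
  (orbit : kepler_orbit q p)
  (energy : hamiltonian (q 0) (p 0) = h) (h_lt0 : h < 0)
  (ecc : eccentricity (q 0) (p 0) = e) (e_bounds : 0 <= e < 1)
  (periapsis : periapsis_at0 q)
  (eps_anomaly : eccentric_anomaly q (semi_major_axis h) e eps)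
  (rs : forall t, (r t, s t) = (Smap (q t) (p t)).1)
  (theta0 : theta 0 = 0)
  (dtheta : forall t : R,
     is_derive t (1 : R) theta (Num.sqrt (- (2 * h)) / enorm (q t)))
  (r_rot : forall t, r t = cos (theta t) *: r 0 + sin (theta t) *: s 0)
  (s_rot : forall t, s t = - sin (theta t) *: r 0 + cos (theta t) *: s 0) :
  forall t, theta t = eps t.
Proof.
case: eps_anomaly => _ eps0 radius kep t.
have w0 : 0 < Num.sqrt (- (2 * h)) by rewrite sqrtr_gt0; lra.
move: radius kep dtheta; rewrite semi_major_axisE//.
move: (Num.sqrt _) w0 => w w0; rewrite mean_motionE// => radius kep dtheta.
suff : theta t - eps t = theta 0 - eps 0.
  by rewrite theta0 eps0 subrr => /subr0_eq.
apply: (@is_derive_0_is_cst _ (theta - eps)) => u.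
have deps : is_derive u (1 : R) eps (w ^+ 3 / (1 - e * cos (eps u))).
  by apply: is_derive_kepler_solution => //; rewrite expf_neq0 ?gt_eqF.
(* With [|q| = (1 - e cos eps) / w^2], the rate [w / |q|] of [theta] becomes that of [eps]. *)
apply: is_derive_eq; rewrite radius; apply/eqP; rewrite subr_eq0; apply/eqP.
have w1 : w != 0 by rewrite gt_eqF.
have k1 : 1 - e * cos (eps u) != 0 by rewrite gt_eqF ?kepler_slope_gt0.
by field; rewrite w1 k1.
Qed.
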